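(* Let $(M,g)$ be a spacetime, let $p\in M$ be an arbitrary point, and let $T:T_pM\to T_pM$ be an endomorphism that is self-adjoint with respect to $g$. Then: 1. $T^2=0$ if and only if there exists a null vector $\ell\in T_pM$ such that $T(\{\ell\}^\perp)=0$. 2. $T^3=0$ if and only if there exists a null vector $\ell\in T_pM$ such that $T(T_pM)\subset\{\ell\}^\perp$ and $T(\{\ell\}^\perp)\subset\mathbb{R}\ell$. 3. $T$ is nilpotent if and only if $T^3=0$.
   Context: A spacetime is a Lorentzian manifold $(M,g)$. A null vector is a nonzero vector $\ell$ with $g(\ell,\ell)=0$. $\{\ell\}^\perp=\{W\in T_pM: g(W,\ell)=0\}$ is the orthogonal complement of $\ell$ (it contains $\ell$). $T$ is self-adjoint if $g(TX,Y)=g(X,TY)$ for all $X,Y\in T_pM$. *)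

(* Defs.v *)
From HB Require Import structures.
From mathcomp Require Import all_boot all_order all_algebra.
From mathcomp Require Import all_classical all_reals all_analysis.

Set Implicit Arguments.
Unset Strict Implicit.
Unset Printing Implicit Defensive.

Import Order.TTheory GRing.Theory Num.Theory.
Import numFieldNormedType.Exports.

Local Open Scope classical_set_scope.
Local Open Scope ring_scope.

(* On an open set U of a finite-dimensional space this is C^infinity: all the
   iterated directional derivatives of f exist and, being differentiable, are
   continuous. *)
Definition smooth_on (R : realType) (V W : normedModType R) (U : set V)
    (f : V -> W) : Prop :=
  forall (vs : seq V) (x : V), U x ->
    differentiable (foldr (fun v h => 'D_v h) f vs) x.

(* A smooth n-manifold given by an atlas. [param i] inverts the chart
   [coord i] on its domain; the values of [coord i] outside [chart_dom i] and
   of [param i] outside [coord i @` chart_dom i] are irrelevant. *)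
Record manifold (R : realType) (n : nat) := Manifold {
  point :> topologicalType;
  manifold_hausdorff : hausdorff_space point;
  manifold_second_countable : second_countable (T := point);
  chart_index : Type;
  chart_dom : chart_index -> set point;
  coord : chart_index -> point -> 'rV[R]_n;
  param : chart_index -> 'rV[R]_n -> point;
  chart_cover : forall p, exists i, chart_dom i p;
  chart_dom_open : forall i, open (chart_dom i);
  coord_image_open : forall i, open (coord i @` chart_dom i);
  coordK : forall i p, chart_dom i p -> param i (coord i p) = p;
  coord_continuous : forall i, {within chart_dom i, continuous (coord i)};
  param_continuous : forall i,
    {within coord i @` chart_dom i, continuous (param i)};
  transition_smooth : forall i j,
    smooth_on (coord i @` (chart_dom i `&` chart_dom j))
      (coord j \o param i)
}.

Section TangentSpace.
Variables (R : realType) (n : nat) (M : manifold R n) (p : M).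

(* A tangent vector at p is the family of its components in the charts around
   p, related by the differentials of the transition maps; the components at
   charts not containing p carry no information and are set to 0. *)
Definition is_tangent : {pred (chart_index M -> 'rV[R]_n)} :=
  fun v => `[< (forall i, ~ chart_dom i p -> v i = 0) /\
    (forall i j, chart_dom i p -> chart_dom j p ->
       v j = 'd (coord j \o param i) (coord i p) (v i)) >].

Lemma is_tangent_submod_closed : submod_closed is_tangent.
Proof.
split; first by apply/asboolP; split=> [//|i j _ _]; rewrite linear0.
move=> a u v /asboolP [u0 ut] /asboolP [v0 vt]; apply/asboolP; split.
  move=> i Ni; rewrite !fctE u0 // v0 // scaler0 addr0 //.
move=> i j pi pj; rewrite !fctE linearP -ut // -vt //.
Qed.

HB.instance Definition _ :=
  GRing.isSubmodClosed.Build R (chart_index M -> 'rV[R]_n) is_tangent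
    is_tangent_submod_closed.

Record tangent := Tangent {
  component :> chart_index M -> 'rV[R]_n;
  componentP : component \in is_tangent
}.

HB.instance Definition _ := [isSub for component].
HB.instance Definition _ := [Choice of tangent by <:].
HB.instance Definition _ :=
  [SubChoice_isSubLmodule of tangent by <:].

End TangentSpace.

Section ScalarProduct.
Variables (R : realType) (V : lmodType R).

Definition is_basis (n : nat) (e : 'I_n -> V) : Prop :=
  bijective (fun c : 'rV[R]_n => \sum_(i < n) c 0 i *: e i).

(* Signature (-,+,...,+) in dimension at least 2; without the dimension bound
   a negative definite line would qualify, and it has no null vector. *)
Definition lorentzian (n : nat) (g : V -> V -> R) : Prop :=
  (2 <= n)%N /\
  exists2 e : 'I_n -> V, is_basis e &
    forall i j, g (e i) (e j) =
      if i != j then 0 else if val i == 0%N then -1 else 1.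

Definition null (g : V -> V -> R) (l : V) : Prop := l != 0 /\ g l l = 0.

Definition perp (g : V -> V -> R) (l : V) : set V := [set w | g w l = 0].

Definition line (l : V) : set V := [set c *: l | c in [set: R]].

Definition self_adjoint (g : V -> V -> R) (T : V -> V) : Prop :=
  forall x y, g (T x) y = g x (T y).

(* [power_zero T k] is T^k = 0. *)
Definition power_zero (T : V -> V) (k : nat) : Prop :=
  forall x, iter k T x = 0.

Definition nilpotent_endo (T : V -> V) : Prop := exists k, power_zero T k.

End ScalarProduct.

(* Smoothness says that in each chart the Gram matrix of the metric, as a
   function of the coordinates, is smooth. *)
Record spacetime (R : realType) (n : nat) := Spacetime {
  spacetime_manifold :> manifold R n;
  metric : forall p : spacetime_manifold, tangent p -> tangent p -> R;
  metric_linear : forall p (x : tangent p), scalar (metric x);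
  metric_sym : forall p (x y : tangent p), metric x y = metric y x;
  metric_lorentzian : forall p, lorentzian n (@metric p);
  metric_smooth : forall i : chart_index spacetime_manifold,
    exists2 G : 'rV[R]_n -> 'M[R]_n,
      smooth_on (coord i @` chart_dom i) G &
      forall p (x y : tangent p), chart_dom i p ->
        metric x y = (x i *m G (coord i p) *m (y i)^T) 0 0
}.

Arguments metric {R n} M p : rename.

(* Main.v *)
(* Orthogonal isotropic vectors of a Lorentzian product are proportional: a
   suitable combination of them has no time component, hence is spacelike and
   isotropic, hence zero.  So a totally isotropic subspace is at most a line,
   and by self-adjointness the image of T^k is totally isotropic as soon as
   T^(2k) = 0.  The vector l is taken in the image of T, resp. T^2, when that
   image is nonzero. *)

Require Import Defs.
From HB Require Import structures.
From mathcomp Require Import all_boot all_order all_algebra.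
From mathcomp Require Import all_classical all_reals all_analysis.
Import numFieldNormedType.Exports.
Local Open Scope classical_set_scope.
Local Open Scope ring_scope.

Import Order.TTheory GRing.Theory Num.Theory.

Section LorentzianProduct.
Set Implicit Arguments.
Unset Strict Implicit.
Context {R : realType} {V : lmodType R} (g : V -> V -> R).
Hypothesis g_linear : forall x, scalar (g x).
Hypothesis g_sym : forall x y, g x y = g y x.

Lemma form0r x : g x 0 = 0.
Proof. by have := g_linear x (-1) 0 0; rewrite scaler0 addr0 mulN1r addNr. Qed.

Lemma formDr x y z : g x (y + z) = g x y + g x z.
Proof. by have := g_linear x 1 y z; rewrite scale1r mul1r. Qed.

Lemma formZr x a y : g x (a *: y) = a * g x y.
Proof. by have := g_linear x a y 0; rewrite form0r !addr0. Qed.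

Lemma formDl x y z : g (y + z) x = g y x + g z x.
Proof. by rewrite g_sym formDr !(g_sym x). Qed.

Lemma formZl x a y : g (a *: y) x = a * g y x.
Proof. by rewrite g_sym formZr g_sym. Qed.

Lemma form_sumr x m (f : 'I_m -> V) :
  g x (\sum_(i < m) f i) = \sum_(i < m) g x (f i).
Proof. by apply: (big_morph (g x)); [exact: formDr | exact: form0r]. Qed.

(** The witness is the timelike basis vector [e ord0]: orthogonality to it kills the time coordinate
    of [x], and [g x x] is then the sum of the squares of all coordinates. *)
Lemma lorentzian_timelike n : lorentzian n g ->
  exists t : V, forall x, g x t = 0 -> g x x = 0 -> x = 0.
Proof.
case: n => [[]//|n] [_ [e [coords _ sum_coords] ge]].
exists (e ord0) => x; rewrite -(sum_coords x).
move: (coords x) => c; set s := \sum_i _.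
have gs i : g s (e i) = c 0 i * (if val i == 0%N then -1 else 1).
  rewrite g_sym form_sumr (bigD1 i) //= big1 ?addr0 => [|j ji].
    by rewrite formZr ge eqxx.
  by rewrite formZr ge eq_sym ji mulr0.
rewrite gs /= mulrN1 => /eqP; rewrite oppr_eq0 => /eqP c0.
rewrite {2}/s form_sumr => gss.
have {gss} : \sum_i c 0 i ^+ 2 = 0.
  rewrite -[RHS]gss; apply: eq_bigr => i _; rewrite formZr gs.
  have [i0|_] := eqVneq (val i) 0%N; last by rewrite mulr1 expr2.
  by have -> : i = ord0 by [exact: val_inj]; rewrite c0 expr0n !mul0r.
move=> /psumr_eq0P sq0; rewrite /s big1 // => i _.
have /eqP : c 0 i ^+ 2 = 0 by apply: sq0 => // j _; exact: sqr_ge0.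
by rewrite sqrf_eq0 => /eqP ->; rewrite scale0r.
Qed.

Context {n : nat} (g_lorentzian : lorentzian n g).

Lemma form_nondegenerate x : (forall y, g x y = 0) -> x = 0.
Proof.
have [t tP] := lorentzian_timelike g_lorentzian.
by move=> gx0; apply: tP.
Qed.

Lemma orthogonal_isotropic l w :
  null g l -> g w w = 0 -> g w l = 0 -> line l w.
Proof.
have [t tP] := lorentzian_timelike g_lorentzian.
(* The coefficient makes [w - c *: l] orthogonal to [t]; this difference is also isotropic, so it
   vanishes. *)
move=> [l_neq0 gll] gww gwl; exists (g w t / g l t) => //.
have glt : g l t != 0.
  by apply: contra_neq l_neq0 => glt0; exact: tP.
apply/esym/eqP; rewrite -subr_eq0 -scaleNr; apply/eqP/tP.
  by rewrite formDl formZl mulNr divfK // subrr.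
rewrite !(formDl, formDr, formZl, formZr) (g_sym l w) gll gww gwl.
by rewrite !mulr0 !addr0.
Qed.

(** Since [l] lies in its own complement, [w] is orthogonal to [l]; hence [w] lies in that
    complement too and is orthogonal to itself. *)
Lemma perp_perp l w : null g l -> (forall y, perp g l y -> g w y = 0) ->
  line l w.
Proof.
move=> nl w_perp; have gwl : g w l = 0 by apply: w_perp; case: nl.
by apply: orthogonal_isotropic => //; exact: w_perp.
Qed.

(** In dimension at least 2 the sum of the timelike and one spacelike basis vector has square -1 +
    1. *)
Lemma null_exists : exists l, null g l.
Proof.
case: n g_lorentzian => [|[|m]] [//] _ [e [coords coordsK _] ge].
pose i1 : 'I_m.+2 := lift ord0 ord0.
have eE (i : 'I_m.+2) : \sum_(j < m.+2) (delta_mx 0 i : 'rV[R]_m.+2) 0 j *: e j = e i.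
  rewrite (bigD1 i) //= big1 ?addr0 => [|j ji].
    by rewrite mxE !eqxx scale1r.
  by rewrite mxE (negPf ji) andbF scale0r.
exists (e ord0 + e i1); split; last first.
  rewrite !(formDl, formDr) !ge /=; by rewrite addr0 add0r addNr.
apply/eqP => e0.
have : (delta_mx 0 ord0 + delta_mx 0 i1 : 'rV[R]_m.+2) = 0.
  apply: (can_inj coordsK); rewrite [RHS]big1 => [|j _]; last first.
    by rewrite mxE scale0r.
  rewrite -[RHS]e0 -(eE ord0) -(eE i1) -big_split /=.
  by apply: eq_bigr => j _; rewrite mxE scalerDl.
move=> /matrixP /(_ 0 ord0); rewrite !mxE !eqxx /= addr0 => /eqP.
by rewrite oner_eq0.
Qed.

Section SelfAdjoint.
Context (T : {linear V -> V}) (T_adj : self_adjoint g T).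

Lemma power_zero2P : power_zero T 2 <->
  exists l, null g l /\ T @` perp g l = [set 0].
Proof.
split=> [T2 | [l [nl Tl]] x].
  (* If the image of [T] lies in the line of [l] and [w] is orthogonal to [l], then
     [g (T w) y = g w (T y) = 0] for all [y]. *)
  suff [l nl Tl] : exists2 l, null g l & forall y, line l (T y).
    exists l; split=> //; apply/seteqP; split=> [_ [w lw <-]|_ ->]; last first.
      by exists 0; rewrite ?linear0 // /perp /= g_sym form0r.
    apply: form_nondegenerate => y; rewrite T_adj.
    by have [c _ <-] := Tl y; rewrite formZr lw mulr0.
  have [T0|] := pselect (forall y, T y = 0).
    have [l nl] := null_exists; exists l => // y.
    by exists 0; rewrite // T0 scale0r.
  move=> /existsNP [x /eqP Tx0]; exists (T x) => [|y].
    by split=> //; rewrite T_adj [T (T x)](T2 x) form0r.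
  apply: orthogonal_isotropic; rewrite ?T_adj ?[T (T _)]T2 ?form0r //.
  by split=> //; rewrite T_adj [T (T x)](T2 x) form0r.
have Tl0 y : perp g l y -> T y = 0.
  by move=> ly; have : (T @` perp g l) (T y) by [exists y]; rewrite Tl.
(* [T x] is orthogonal to everything [T] kills, in particular to [perp g l]; so it is a multiple of
   [l], itself killed by [T]. *)
have [c _ Tx] : line l (T x).
  by apply: perp_perp => // y ly; rewrite T_adj Tl0 // form0r.
by rewrite /= -Tx linearZ /= Tl0 ?scaler0 //; case: nl.
Qed.

Lemma power_zero3P : power_zero T 3 <->
  exists l, [/\ null g l, range T `<=` perp g l & T @` perp g l `<=` line l].
Proof.
split=> [T3 | [l [nl Tperp Tline]] x]; last first.
  (* By self-adjointness, the kernel of [T] contains every vector orthogonal to its range. *)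
  have Tl : T l = 0.
    apply: form_nondegenerate => y; rewrite T_adj g_sym.
    by apply: Tperp; exists y.
  have [c _ TTx] : line l (T (T x)).
    by apply: Tline; exists (T x) => //; apply: Tperp; exists x.
  by rewrite /= -TTx linearZ /= Tl scaler0.
have T3E y : T (T (T y)) = 0 := T3 y.
have [T2|] := pselect (power_zero T 2).
  have [l [nl Tl]] := power_zero2P.1 T2; exists l.
  have Tl0 y : perp g l y -> T y = 0.
    by move=> ly; have : (T @` perp g l) (T y) by [exists y]; rewrite Tl.
  split=> // [_ [x _ <-]|_ [w lw <-]].
    by rewrite /perp /= T_adj Tl0 ?form0r //; case: nl.
  by exists 0; rewrite // Tl0 // scale0r.
move=> /existsNP [x /eqP /= TTx0]; exists (T (T x)).
have nl : null g (T (T x)) by split=> //; rewrite T_adj T3E form0r.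
split=> // [_ [y _ <-]|_ [w lw <-]]; first by rewrite /perp /= T_adj T3E form0r.
apply: orthogonal_isotropic => //; rewrite T_adj ?T3E ?form0r //.
(* It remains to see that [g w (T (T w))] is zero: [T (T w)] is a multiple of [T (T x)], to which
   [w] is orthogonal. *)
have [|| c _ <-] := @orthogonal_isotropic (T (T x)) (T (T w)) nl.
- by rewrite T_adj T3E form0r.
- by rewrite T_adj T3E form0r.
by rewrite formZr lw mulr0.
Qed.

Lemma self_adjoint_iter k : self_adjoint g (iter k T).
Proof.
by elim: k => [//|k IH] x y; rewrite iterS T_adj IH -iterSr.
Qed.

Lemma iter_linear0 k : iter k T 0 = 0.
Proof. by elim: k => [//|k /= ->]; rewrite linear0. Qed.

(** The image of the power just below [k] is totally isotropic and stable under [T]. A nonzero [l]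
    in it is thus an eigenvector, and [T (T l) = 0] forces its eigenvalue to be 0. *)
Lemma power_zero_step k : (3 < k.+1)%N -> power_zero T k.+1 -> power_zero T k.
Proof.
case: k => [//|k] k_gt Tk x; rewrite iterS.
have iso y z : g (iter k T y) (iter k T z) = 0.
  rewrite self_adjoint_iter -iterD.
  (* The exponent bound enters here: after the case split it says that [k] is at least 2. *)
  have -> : (k + k = (k - 2) + k.+2)%N by rewrite addnBAC // !addnS subn2.
  by rewrite iterD Tk iter_linear0 form0r.
have [->|l0] := eqVneq (iter k T x) 0; first by rewrite linear0.
set l := iter k T x in l0 *.
have [||| c _ Tl] := @orthogonal_isotropic l (T l).
- by split; rewrite ?iso.
- by rewrite /l -iterS iterSr iso.
- by rewrite /l -iterS iterSr iso.
have : T (T l) = 0 by exact: Tk.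
rewrite -Tl linearZ /= -Tl scalerA => /eqP.
by rewrite scaler_eq0 (negPf l0) orbF mulf_eq0 orbb => /eqP ->; rewrite scale0r.
Qed.

Lemma nilpotent_endoP : nilpotent_endo T <-> power_zero T 3.
Proof.
split=> [[k]|T3]; last by exists 3%N.
elim: k => [|k IH] Tk.
  (* The zeroth power is the identity, so its vanishing means that the space is zero. *)
  by move=> x; have -> : x = 0 := Tk x; exact: iter_linear0.
have [k3|k3] := leqP k.+1 3; last by apply: IH; exact: power_zero_step.
by move=> x; rewrite -(subnK k3) iterD Tk iter_linear0.
Qed.

End SelfAdjoint.
End LorentzianProduct.

Theorem proposition2p1 (R : realType) (n : nat) (M : spacetime R n) (p : M)
    (T : {linear tangent p -> tangent p})
    (T_self_adjoint : self_adjoint (metric M p) T) :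
  [/\ power_zero T 2 <->
        (exists l : tangent p, null (metric M p) l /\
           T @` perp (metric M p) l = [set 0]),
      power_zero T 3 <->
        (exists l : tangent p, [/\ null (metric M p) l,
           range T `<=` perp (metric M p) l &
           T @` perp (metric M p) l `<=` line l])
    & nilpotent_endo T <-> power_zero T 3].
Proof.
have gl := @metric_linear R n M p; have gs := @Defs.metric_sym R n M p.
have gL := @metric_lorentzian R n M p.
split.
- exact (power_zero2P gl gs gL T_self_adjoint).
- exact (power_zero3P gl gs gL T_self_adjoint).
- exact (nilpotent_endoP gl gs gL T_self_adjoint).
Qed.
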